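(* Let $X_1,\dots,X_n$ be smooth manifolds and let $c: X_1\times\cdots\times X_n\to\mathbb{R}$ be a cost function satisfying the standing assumptions. Assume that $c$ is continuously differentiable with respect to the first variable and that $S\subset X_1\times\cdots\times X_n$ is a compact $c$-splitting set. If $c$ is locally $1$-twisted on $S$, then $c$ satisfies the generalized-twist condition on $S$; that is, for every $(\bar x_1,\dots,\bar x_n)\in S$ the set $$\Big\{(\bar x_1,x_2,\dots,x_n)\in S:\ D_{x_1}c(\bar x_1,\bar x_2,\dots,\bar x_n)=D_{x_1}c(\bar x_1,x_2,\dots,x_n)\Big\}$$ is finite.
   Context: Setting. $X_1,\dots,X_n$ are smooth manifolds carrying Borel probability measures $\mu_1,\dots,\mu_n$. $\Pi(\mu_1,\dots,\mu_n)$ is the set of Borel probability measures on $X_1\times\cdots\times X_n$ whose $X_i$-marginal is $\mu_i$ for each $i$. For $\pi\in\Pi(\mu_1,\dots,\mu_n)$, $I_c(\pi)=\int c\,d\pi$. The problem $(MK)$ is $\inf\{I_c(\pi):\pi\in\Pi(\mu_1,\dots,\mu_n)\}$, and a minimizer is called an optimal plan. Standing assumptions on $c$. $c: X_1\times\cdots\times X_n\to\mathbb{R}$ is non-negative, lower semi-continuous, differentiable with respect to the first variable at $\mu_1\otimes\cdots\otimes\mu_n$-almost every point, and $I_c(\pi)$ is finite for some $\pi\in\Pi(\mu_1,\dots,\mu_n)$. Moreover, the Kantorovich dual problem admits a solution: there are Borel functions $\varphi_i:X_i\to\mathbb{R}$, $\varphi_i\in L^1(\mu_i)$, such that $\varphi_1$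 is differentiable $\mu_1$-a.e., $\varphi_1(x_1)+\cdots+\varphi_n(x_n)\le c(x_1,\dots,x_n)$ for all $(x_1,\dots,x_n)$, and $\int c\,d\gamma=\sum_{i=1}^n\int_{X_i}\varphi_i\,d\mu_i$ for optimal plans $\gamma$. $D_{x_1}c$ denotes the derivative of $c$ with respect to the first variable. ''Continuously differentiable with respect to the first variable'' means that $D_{x_1}c$ exists at every point of $X_1\times\cdots\times X_n$ and is continuous on $X_1\times\cdots\times X_n$. $c$-splitting set. A set $S\subset X_1\times\cdots\times X_n$ is a $c$-splitting set if there exist Borel functions $u_i:X_i\to\mathbb{R}$ such that $\sum_{i=1}^n u_i(x_i)\le c(x_1,\dots,x_n)$ for all $(x_1,\dots,x_n)$, with equality whenever $(x_1,\dots,x_n)\in S$. Local $1$-twistedness. $c$ is locally $1$-twisted on $S$ if every $(\bar x_1,\dots,\bar x_n)\in S$ has a neighborhood $U$ in $X_1\times\cdots\times X_n$ such that the set $\{(\bar x_1,x_2,\dots,x_n)\in S\cap U:\ D_{x_1}c(\bar x_1,\bar x_2,\dots,\bar x_n)=D_{x_1}c(\bar x_1,x_2,\dots,x_n)\}$ has at most one element. *)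

(* Defs.v *)
From HB Require Import structures.
From mathcomp Require Import all_boot all_order all_algebra.
From mathcomp Require Import all_classical all_reals all_analysis.

Set Implicit Arguments.
Unset Strict Implicit.
Unset Printing Implicit Defensive.

Import Order.TTheory GRing.Theory Num.Theory.
Import numFieldNormedType.Exports.

Local Open Scope classical_set_scope.
Local Open Scope ring_scope.

(* For U open and V finite-dimensional, f is C^(k+1) on U iff f is differentiable
   on U and each directional derivative x |-> 'D_v f x is C^k on U. *)
Fixpoint Ck_on (R : realType) (V W : normedModType R) (k : nat)
    (U : set V) (f : V -> W) : Prop :=
  match k with
  | 0%N => forall x, U x -> {for x, continuous f}
  | k'.+1 => (forall x, U x -> differentiable f x) /\
             forall v : V, Ck_on k' U (fun x => 'D_v f x)
  end.

Definition smooth_on (R : realType) (V W : normedModType R)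
    (U : set V) (f : V -> W) : Prop :=
  forall k, Ck_on k U f.

(* [chart_fun] and [chart_inv] are total functions, meaningful only on
   [chart_dom] and on [chart_fun @` chart_dom] respectively. *)
Record chart (R : realType) (T : topologicalType) (d : nat) := Chart {
  chart_dom : set T ;
  chart_fun : T -> 'rV[R]_d ;
  chart_inv : 'rV[R]_d -> T ;
  chart_dom_open : open chart_dom ;
  chart_img_open : open (chart_fun @` chart_dom) ;
  chart_funK : forall p, chart_dom p -> chart_inv (chart_fun p) = p ;
  chart_fun_continuous : {within chart_dom, continuous chart_fun} ;
  chart_inv_continuous :
    {within chart_fun @` chart_dom, continuous chart_inv} }.

(* The base point of [ptopologicalType] is required by the library's measurable
   types; it only says that the manifold is nonempty, as is every space carrying
   a probability measure. *)
Record smooth_manifold (R : realType) := SmoothManifold {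
  mcarrier :> ptopologicalType ;
  mdim : nat ;
  matlas : set (chart R mcarrier mdim) ;
  mhausdorff : hausdorff_space mcarrier ;
  msecond_countable : @second_countable mcarrier ;
  matlas_cover : forall p, exists2 e, matlas e & chart_dom e p ;
  matlas_smooth : forall e e', matlas e -> matlas e' ->
    smooth_on (chart_fun e @` (chart_dom e `&` chart_dom e'))
              (chart_fun e' \o chart_inv e) }.

Definition mdifferentiable (R : realType) (M : smooth_manifold R)
    (f : M -> R) (p : M) : Prop :=
  forall e, matlas e -> chart_dom e p ->
    differentiable (f \o chart_inv e) (chart_fun e p).

Definition dcoord (R : realType) (M : smooth_manifold R)
    (e : chart R M (mdim M)) (f : M -> R) (p : M) : 'rV[R]_(mdim M) :=
  \row_j 'd (f \o chart_inv e) (chart_fun e p) (delta_mx 0 j).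

Definition chart_at (R : realType) (M : smooth_manifold R) (p : M) :=
  {e : chart R M (mdim M) | matlas e /\ chart_dom e p}.

(* The derivative of f at p, a cotangent vector at p, represented by its
   components in all the charts around p. *)
Definition mdiff (R : realType) (M : smooth_manifold R)
    (f : M -> R) (p : M) : chart_at p -> 'rV[R]_(mdim M) :=
  fun e => dcoord (sval e) f p.
Arguments mdiff {R M} f p.

(* The factors X_1, ..., X_n (n >= 1) are indexed by ['I_m.+1] with n = m + 1;
   the first variable has index [ord0]. *)

Definition mprod (R : realType) (m : nat)
    (X : 'I_m.+1 -> smooth_manifold R) : Type :=
  prod_topology (fun i => X i : ptopologicalType).

HB.instance Definition _ (R : realType) (m : nat)
    (X : 'I_m.+1 -> smooth_manifold R) :=
  Topological.on (mprod X).
HB.instance Definition _ (R : realType) (m : nat)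
    (X : 'I_m.+1 -> smooth_manifold R) :=
  Pointed.copy (mprod X) (forall i, (X i : ptopologicalType)).

Definition slice1 (R : realType) (m : nat) (X : 'I_m.+1 -> smooth_manifold R)
    (c : mprod X -> R) (x : mprod X) : X ord0 -> R :=
  fun p => c (dfwith x ord0 p).

Definition differentiable1 (R : realType) (m : nat)
    (X : 'I_m.+1 -> smooth_manifold R) (c : mprod X -> R) (x : mprod X) : Prop :=
  mdifferentiable (slice1 c x) (x ord0).

(* [D1 c p x] is D_{x_1} c (p, x_2, ..., x_n); the component [x ord0] is ignored,
   so that derivatives at points with first coordinate p share one type. *)
Definition D1 (R : realType) (m : nat) (X : 'I_m.+1 -> smooth_manifold R)
    (c : mprod X -> R) (p : X ord0) (x : mprod X) :
    chart_at p -> 'rV[R]_(mdim (X ord0)) :=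
  mdiff (slice1 c x) p.
Arguments D1 {R m X} c p x.

(* Continuity of D_{x_1} c into the cotangent bundle of X_1, expressed in the
   local trivializations induced by the charts of X_1. *)
Definition continuously_differentiable1 (R : realType) (m : nat)
    (X : 'I_m.+1 -> smooth_manifold R) (c : mprod X -> R) : Prop :=
  (forall x, differentiable1 c x) /\
  (forall e : chart R (X ord0) (mdim (X ord0)), matlas e ->
     forall x : mprod X, chart_dom e (x ord0) ->
       {for x, continuous (fun y : mprod X => dcoord e (slice1 c y) (y ord0))}).

Definition borel (T : ptopologicalType) := g_sigma_algebraType (@open T).

Definition is_plan (R : realType) (m : nat) (X : 'I_m.+1 -> smooth_manifold R)
    (mu : forall i, probability (borel (X i)) R)
    (pi : probability (borel (mprod X)) R) : Prop :=
  forall i (A : set (borel (X i))), measurable A ->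
    pi [set x | A (x i)] = mu i A.

Definition transport_cost (R : realType) (m : nat)
    (X : 'I_m.+1 -> smooth_manifold R) (c : mprod X -> R)
    (pi : probability (borel (mprod X)) R) : \bar R :=
  (\int[pi]_x (c x)%:E)%E.

Definition optimal_plan (R : realType) (m : nat)
    (X : 'I_m.+1 -> smooth_manifold R)
    (mu : forall i, probability (borel (X i)) R) (c : mprod X -> R)
    (pi : probability (borel (mprod X)) R) : Prop :=
  is_plan mu pi /\
  forall pi', is_plan mu pi' -> (transport_cost c pi <= transport_cost c pi')%E.

(* mu_1 (x) ... (x) mu_n, as the outer measure obtained from countable covers by
   measurable boxes (Caratheodory); on Borel sets it is the product measure. *)
Definition product_measure (R : realType) (m : nat)
    (X : 'I_m.+1 -> smooth_manifold R)
    (mu : forall i, probability (borel (X i)) R)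
    (A : set (borel (mprod X))) : \bar R :=
  ereal_inf [set (\sum_(0 <= k <oo) \prod_(i < m.+1) mu i (B k i))%E
    | B in [set B : nat -> forall i, set (borel (X i)) |
        (forall k i, measurable (B k i)) /\
        A `<=` \bigcup_k [set x | forall i, B k i (x i)]]].

Definition dual_solution (R : realType) (m : nat)
    (X : 'I_m.+1 -> smooth_manifold R)
    (mu : forall i, probability (borel (X i)) R) (c : mprod X -> R)
    (phi : forall i, borel (X i) -> R) : Prop :=
  [/\ forall i, measurable_fun [set: borel (X i)] (phi i),
      forall i, (mu i).-integrable setT (EFin \o phi i),
      {ae mu ord0, forall p, mdifferentiable (phi ord0) p},
      forall x : mprod X, \sum_i phi i (x i) <= c x &
      forall gamma, optimal_plan mu c gamma ->
        transport_cost c gamma = (\sum_i \int[mu i]_p (phi i p)%:E)%E].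

Definition standing_assumptions (R : realType) (m : nat)
    (X : 'I_m.+1 -> smooth_manifold R)
    (mu : forall i, probability (borel (X i)) R) (c : mprod X -> R) : Prop :=
  [/\ forall x, 0 <= c x,
      lower_semicontinuous (EFin \o c),
      almost_everywhere (product_measure mu) (differentiable1 c),
      exists2 pi, is_plan mu pi & transport_cost c pi \is a fin_num &
      exists phi, dual_solution mu c phi].

Definition splitting_set (R : realType) (m : nat)
    (X : 'I_m.+1 -> smooth_manifold R) (c : mprod X -> R)
    (S : set (mprod X)) : Prop :=
  exists u : forall i, borel (X i) -> R,
    [/\ forall i, measurable_fun [set: borel (X i)] (u i),
        forall x : mprod X, \sum_i u i (x i) <= c x &
        forall x : mprod X, S x -> \sum_i u i (x i) = c x].

Definition twist_fiber (R : realType) (m : nat)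
    (X : 'I_m.+1 -> smooth_manifold R) (c : mprod X -> R)
    (S : set (mprod X)) (xbar : mprod X) : set (mprod X) :=
  [set x | [/\ S x, x ord0 = xbar ord0 &
               D1 c (xbar ord0) xbar = D1 c (xbar ord0) x]].

Definition locally_1_twisted (R : realType) (m : nat)
    (X : 'I_m.+1 -> smooth_manifold R) (c : mprod X -> R)
    (S : set (mprod X)) : Prop :=
  forall xbar, S xbar -> exists2 U, nbhs xbar U &
    is_subset1 (twist_fiber c (S `&` U) xbar).

Definition generalized_twist (R : realType) (m : nat)
    (X : 'I_m.+1 -> smooth_manifold R) (c : mprod X -> R)
    (S : set (mprod X)) : Prop :=
  forall xbar, S xbar -> finite_set (twist_fiber c S xbar).

(* Main.v *)
Require Import Defs.
From HB Require Import structures.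
From mathcomp Require Import all_boot all_order all_algebra.
From mathcomp Require Import all_classical all_reals all_analysis.

(** Let F be the fiber through a point [x] of S, that is, the set of points of S
    that share with [x] the first coordinate and the derivative in the first
    variable. The first projection and the components of [D_{x_1} c] in a chart
    around the first coordinate of [x] are continuous with values in Hausdorff
    spaces, so F is relatively closed in S: a point of S outside F has a
    neighborhood that misses F ([twist_fiber_avoid]). A point of F has the same
    fiber as [x] ([twist_fiber_sub]), so by local 1-twistedness it has a
    neighborhood that meets F in at most one point. Hence every point of the
    compact set S has a neighborhood that meets F in finitely many points, and F
    is finite ([compact_locally_finite]). *)

Import numFieldNormedType.Exports.
Local Open Scope classical_set_scope.

Lemma compact_locally_finite (T : topologicalType) (S F : set T) :
  compact S -> F `<=` S ->
  (forall y, S y -> exists2 U, nbhs y U & finite_set (F `&` U)) ->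
  finite_set F.
Proof.
move=> cS FS locF; apply: contrapT => Finf.
(* If F is infinite, the sets that contain all but finitely many points of F form
   a proper filter, which has a cluster point in S; every neighborhood of a
   cluster point meets F in infinitely many points. *)
pose G : set_system T := [set A | finite_set (F `\` A)].
have GE A : G A = finite_set (F `\` A) by [].
have GF : Filter G.
  split; rewrite ?GE.
  - by rewrite setDT; exact: finite_set0.
  - move=> P Q; rewrite !GE => fP fQ.
    by rewrite setDE setCI setIUr -!setDE finite_setU.
  - by move=> P Q PQ; rewrite !GE; apply: sub_finite_set; exact: setDS.
have GP : ProperFilter G by split=> //; rewrite GE setD0.
have GS : G S by rewrite GE; move: FS; rewrite -setD_eq0 => ->; exact: finite_set0.
have [y [Sy cly]] := cS G GP GS.
have [U yU fU] := locF y Sy.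
have GU : G (~` U) by rewrite GE setDE setCK.
by have [z [nUz Uz]] := cly _ _ GU yU.
Qed.

Section TwistFiber.
Context {R : realType} {m : nat} {X : 'I_m.+1 -> smooth_manifold R}.
Variables (c : mprod X -> R) (S : set (mprod X)).
Implicit Types x y : mprod X.

Lemma twist_fiber_sub x y : twist_fiber c S x y ->
  twist_fiber c S x `<=` twist_fiber c S y.
Proof.
move=> [_ y0 Dy] z [Sz z0 Dz].
split; [exact: Sz | exact: etrans z0 (esym y0) | ].
(* The type of [D1 c p] depends on the base point p, so the goal at base point
   [y ord0] is reached by substituting [y ord0 = x ord0]. *)
have : D1 c (x ord0) y = D1 c (x ord0) z.
  exact: etrans (esym Dy) Dz.
by case: _ / y0.
Qed.

Lemma twist_fiber_avoid x y : continuously_differentiable1 c ->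
  S y -> ~ twist_fiber c S x y ->
  exists2 U, nbhs y U & twist_fiber c S x `&` U = set0.
Proof.
move=> [_ cD] Sy nFy.
have [y0|y0] := pselect (y ord0 = x ord0); last first.
  have /hausdorff_accessible/accessible_closed_set1 cl := @mhausdorff R (X ord0).
  exists ((fun z : mprod X => z ord0) @^-1` ~` [set x ord0]).
    apply: (@proj_continuous _ (fun i => X i : ptopologicalType) ord0 y).
    apply: open_nbhs_nbhs; split; first exact: closed_openC.
    exact: y0.
  by rewrite -subset0 => z [[_ z0 _]]; apply.
have [e De] : exists e : chart_at (x ord0),
    D1 c (x ord0) x e <> D1 c (x ord0) y e.
  apply: contrapT => nex; apply: nFy; split; [exact: Sy|exact: y0|].
  apply: funext => e.
  by apply: contrapT => ne; apply: nex; exists e.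
case: e De => e [ae de] De.
have dy : chart_dom e (y ord0) by rewrite y0.
pose v := dcoord e (slice1 c x) (x ord0).
exists ((fun z : mprod X => dcoord e (slice1 c z) (z ord0)) @^-1` ~` [set v]).
  apply: (cD e ae y dy); apply: open_nbhs_nbhs; split.
    by apply: closed_openC; apply: accessible_closed_set1;
      apply: hausdorff_accessible; exact: norm_hausdorff.
  by move=> Ey; apply: De; rewrite y0 in Ey; exact: esym Ey.
rewrite -subset0 => z [[_ z0 Dz]]; apply => /=.
have /= := congr1 (fun h => h (exist _ e (conj ae de))) Dz.
by rewrite /D1 /mdiff /= -/v z0 => ->.
Qed.

End TwistFiber.

Theorem proposition1p1 (R : realType) (m : nat)
    (X : 'I_m.+1 -> smooth_manifold R)
    (mu : forall i, probability (borel (X i)) R)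
    (c : mprod X -> R) (S : set (mprod X)) :
  standing_assumptions mu c ->
  continuously_differentiable1 c ->
  compact S ->
  splitting_set c S ->
  locally_1_twisted c S ->
  generalized_twist c S.
Proof.
move=> _ cD cS _ tw x Sx.
apply: (@compact_locally_finite _ S) => // [y []//|y Sy].
have [Fy|nFy] := pselect (twist_fiber c S x y); last first.
  have [U yU FU0] := twist_fiber_avoid c S x y cD Sy nFy.
  by exists U => //; rewrite FU0; exact: finite_set0.
have [U yU U1] := tw y Sy; exists U => //.
apply: (@sub_finite_set _ _ (twist_fiber c (S `&` U) y)).
  move=> z [Fz Uz]; have [Sz z0 Dz] := twist_fiber_sub c S x y Fy z Fz.
  by split; [exact: (conj Sz Uz)|exact: z0|exact: Dz].
have [->|/set0P[z Fz]] := eqVneq (twist_fiber c (S `&` U) y) set0.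
  exact: finite_set0.
by apply: (@sub_finite_set _ _ [set z]) => [w Fw|]; [exact: U1|exact: finite_set1].
Qed.
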